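(* Let $m,n\geqslant 3$ be integers. Then \[ \chi_{_{=}}(C_m\times C_n)=\chi_{_{=}}^*(C_m\times C_n)=\left\{\begin{array}{ll} 2, & \mbox{if } mn \mbox{ is even;}\\ 3, & \mbox{otherwise.}\end{array}\right. \]
   Context: All graphs are finite, loopless, and without multiple edges. $C_n$ denotes the cycle on $n$ vertices. The cross (direct) product $G_1\times G_2$ of $G_1=(V_1,E_1)$ and $G_2=(V_2,E_2)$ has vertex set $V_1\times V_2$, and $\{(u,x),(v,y)\}$ is an edge if and only if $uv\in E_1$ and $xy\in E_2$. A proper $k$-coloring of $G$ is a function $c:V(G)\to\{0,1,\ldots,k-1\}$ mapping adjacent vertices to distinct numbers; its color classes are $V_i=c^{-1}(i)$, $0\leqslant i\leqslant k-1$. $G$ is equitably $k$-colorable if it has a proper $k$-coloring whose color classes satisfy $\big||V_i|-|V_j|\big|\leqslant 1$ for all $i,j\in\{0,\ldots,k-1\}$. The equitable chromatic number $\chi_{_{=}}(G)$ is the smallest integer $r$ such that $G$ is equitably $r$-colorable. The equitable chromatic threshold $\chi_{_{=}}^*(G)$ is the smallest integer $r$ such that $G$ is equitably $k$-colorable for all $k\geqslant r$. *)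

(* Defs.v *)
From mathcomp Require Import all_boot all_order all_algebra.
From mathcomp Require Import boolp.

Set Implicit Arguments.
Unset Strict Implicit.
Unset Printing Implicit Defensive.

Import Order.TTheory GRing.Theory Num.Theory.

Record sgraph := SGraph {
  vertex :> finType;
  adj : rel vertex;
  adj_sym : symmetric adj;
  adj_irr : irreflexive adj }.

Definition cycle_adj n : rel 'I_n :=
  fun i j => (i != j) && ((j == ordS i) || (i == ordS j)).

Lemma cycle_adj_sym n : symmetric (@cycle_adj n).
Proof. by move=> i j; rewrite /cycle_adj eq_sym orbC. Qed.

Lemma cycle_adj_irr n : irreflexive (@cycle_adj n).
Proof. by move=> i; rewrite /cycle_adj eqxx. Qed.

(* [i != j] matters only for n = 1; the graph is the cycle C_n for n >= 3. *)
Definition cycle_graph n : sgraph :=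
  SGraph (@cycle_adj_sym n) (@cycle_adj_irr n).

Definition cross_adj (G1 G2 : sgraph) : rel (G1 * G2)%type :=
  fun p q => adj p.1 q.1 && adj p.2 q.2.

Lemma cross_adj_sym G1 G2 : symmetric (@cross_adj G1 G2).
Proof. by move=> p q; rewrite /cross_adj adj_sym [adj p.2 _]adj_sym. Qed.

Lemma cross_adj_irr G1 G2 : irreflexive (@cross_adj G1 G2).
Proof. by move=> p; rewrite /cross_adj adj_irr. Qed.

Definition cross_product (G1 G2 : sgraph) : sgraph :=
  SGraph (@cross_adj_sym G1 G2) (@cross_adj_irr G1 G2).

Section Coloring.
Variable G : sgraph.

Definition proper_coloring k (c : {ffun G -> 'I_k}) : bool :=
  [forall u, forall v, adj u v ==> (c u != c v)].

Definition color_class k (c : {ffun G -> 'I_k}) (i : 'I_k) : {set G} :=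
  [set v | c v == i].

Definition equitable k (c : {ffun G -> 'I_k}) : bool :=
  [forall i, forall j,
    `|#|color_class c i|%:Z - #|color_class c j|%:Z| <= 1]%R.

Definition equitably_colorable (k : nat) : bool :=
  [exists c : {ffun G -> 'I_k}, proper_coloring c && equitable c].

Definition equitably_colorable_from (r : nat) : Prop :=
  forall k, r <= k -> equitably_colorable k.

Lemma equitably_colorable_from_card : equitably_colorable_from #|G|.
Proof.
move=> k Gk; apply/existsP.
pose c := [ffun v : G => widen_ord Gk (enum_rank v)].
have c_inj : injective c.
  by move=> u v; rewrite !ffunE => /(congr1 val)/= /val_inj/enum_rank_inj.
have class1 i : #|color_class c i| <= 1.
  apply/card_le1_eqP => u v; rewrite !inE => /eqP cu /eqP cv.
  by apply: c_inj; rewrite cu cv.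
exists c; apply/andP; split.
  apply/forallP => u; apply/forallP => v; apply/implyP => uv.
  by apply/eqP => /c_inj euv; rewrite euv adj_irr in uv.
apply/forallP => i; apply/forallP => j.
by case: #|_| (class1 i) => [|[|]] //; case: #|_| (class1 j) => [|[|]].
Qed.

Lemma ex_equitably_colorable : exists k, equitably_colorable k.
Proof. by exists #|G|; apply: equitably_colorable_from_card. Qed.

Lemma ex_equitably_colorable_from : exists r, `[< equitably_colorable_from r >].
Proof. by exists #|G|; apply/asboolP/equitably_colorable_from_card. Qed.

Definition equitable_chromatic_number : nat :=
  ex_minn ex_equitably_colorable.

Definition equitable_chromatic_threshold : nat :=
  ex_minn ex_equitably_colorable_from.

End Coloring.

(* Main.v *)
Require Import Defs.
From mathcomp Require Import all_boot.
From mathcomp Require Import zify.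

(** Why the theorem holds.  List the N vertices of a graph in some order and
    cut the list into k consecutive blocks whose lengths differ by at most one;
    this is an equitable k-coloring as soon as no block contains an edge
    ([equitably_colorable_blocks]), for instance when any two adjacent vertices
    are at least N/k places apart in the list ([block_neq_far]).

    For C_m x C_n, list the m rows {x} x C_n one after the other, even rows
    before odd rows, so that cyclically consecutive rows are at least
    d = floor((m-1)/2) rows apart; within each row, visit C_n in an order that
    places cyclically consecutive columns at most two places apart.  Adjacent
    vertices are then at least d*n - 2 places apart, and k colors suffice once
    m*n <= k*(d*n - 2) ([equitably_colorable_of_gap]).  With the two factors
    exchanged if need be, this settles all k >= 3 except for finitely many
    triples (m, n, k), all with m, n, k <= 8.  On those a direct evaluation
    finds that the same list, or one of two others, works ([small_products]).
    The list also serves for k = 2 when m is even: its two halves are the even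
    and the odd rows ([equitably_2_colorable_even]).

    Conversely an edge requires two colors, and when m and n are both odd the
    diagonal walk t |-> (t mod m, t mod n) closes up after the odd number m*n
    of steps, which forces a third color ([color_count_gt2_odd]).  Thus
    C_m x C_n is equitably k-colorable exactly for k >= 2, respectively k >= 3,
    so that the number and the threshold coincide. *)

(** * Coloring by blocks of a numbering *)

Definition block N k a := a * k %/ N.

(** Block i consists of the a with i*N <= a*k < (i+1)*N, so it is the interval
    between the ceilings of i*N/k and (i+1)*N/k. *)
Lemma block_count N k i : i < k ->
  count (fun a => block N k a == i) (iota 0 N)
    = ((i * N + N + k.-1) %/ k) - ((i * N + k.-1) %/ k).
Proof.
move=> ik.
have [->|N0] := posnP N; first by rewrite !muln0 subnn.
have kgt0 : 0 < k by lia.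
pose c t := (t * N + k.-1) %/ k.
have below a t : (a * k < t * N) = (a < c t).
  by rewrite /c leq_divRL //; nia.
have count_below t : t <= k ->
    count (fun a => a * k < t * N) (iota 0 N) = c t.
  move=> tk; have cN : c t <= N by rewrite /c -ltnS ltn_divLR //; nia.
  rewrite (eq_count (a2 := fun a => a < c t)) => [|a]; last exact: below.
  rewrite -(subnKC cN) iotaD count_cat add0n.
  rewrite (eq_in_count (a2 := predT)) => [|a].
    rewrite count_predT size_iota (eq_in_count (a2 := pred0)) => [|a].
      by rewrite count_pred0 addn0.
    by rewrite mem_iota /= => /andP[ca _]; apply/negbTE; rewrite -leqNgt.
  by rewrite mem_iota.
have -> : (i * N + N + k.-1) %/ k = c i.+1 by rewrite /c mulSn [N + _]addnC.
rewrite -[(i * N + k.-1) %/ k]/(c i) -(count_below i.+1) //.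
rewrite -(count_below i); last lia.
have -> : count (fun a => a * k < i.+1 * N) (iota 0 N)
  = count (fun a => a * k < i * N) (iota 0 N)
    + count (fun a => block N k a == i) (iota 0 N).
  rewrite -count_predUI [X in _ + X](eq_count (a2 := pred0)) => [|a /=].
    rewrite count_pred0 addn0; apply: eq_count => a /=.
    rewrite /block eqn_leq leq_divRL // -[_ %/ _ <= i]ltnS ltn_divLR //; lia.
  by rewrite /block eqn_leq leq_divRL //; lia.
by rewrite addKn.
Qed.

Lemma block_equitable N k i : i < k ->
  N %/ k <= count (fun a => block N k a == i) (iota 0 N) <= (N %/ k).+1.
Proof.
move=> ik; rewrite (block_count _ _ _ ik).
have kgt0 : 0 < k by lia.
rewrite addnAC (divnD (i * N + k.-1)) //.
move: (leq_b1 (k <= (i * N + k.-1) %% k + N %% k)).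
by move: (nat_of_bool _) (N %/ k) (_ %/ k) => carry q q'; lia.
Qed.

(** An injection of the vertices into [0, N) is a bijection, so the color
    classes have the sizes of the blocks. *)
Lemma equitably_colorable_blocks (G : sgraph) k (f : G -> nat) :
    0 < k -> (forall v, f v < #|G|) -> injective f ->
    (forall u v, adj u v -> block #|G| k (f u) != block #|G| k (f v)) ->
  equitably_colorable G k.
Proof.
move=> k0 f_lt f_inj f_sep.
have blk v : block #|G| k (f v) < k.
  have N0 : 0 < #|G| by apply/card_gt0P; exists v.
  by rewrite /block ltn_divLR // mulnC ltn_pmul2l.
pose c := [ffun v : G => Ordinal (blk v)].
have f_perm : perm_eq [seq f v | v <- enum G] (iota 0 #|G|).
  have f_uniq : uniq [seq f v | v <- enum G].
    by rewrite (map_inj_uniq f_inj) enum_uniq.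
  have f_sub : {subset [seq f v | v <- enum G] <= iota 0 #|G|}.
    by move=> _ /mapP[v _ ->]; rewrite mem_iota /=.
  apply: uniq_perm => //; first exact: iota_uniq.
  by apply: (uniq_min_size f_uniq f_sub _).2; rewrite size_map size_iota cardE.
have class_card i :
    #|color_class c i| = count (fun a => block #|G| k a == i) (iota 0 #|G|).
  rewrite -(permP f_perm) count_map cardE enumT size_filter.
  by apply: eq_count => v; rewrite /= inE ffunE -val_eqE.
apply/existsP; exists c; apply/andP; split.
  apply/forallP => u; apply/forallP => v; apply/implyP => uv.
  by rewrite !ffunE -val_eqE; apply: f_sep.
apply/forallP => i; apply/forallP => j.
rewrite !class_card.
have := block_equitable #|G| k i (ltn_ord i).
have := block_equitable #|G| k j (ltn_ord j).
by lia.
Qed.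

(** * Numberings of the vertices of a product of cycles *)

Lemma equitably_colorable_swap G1 G2 k :
  equitably_colorable (cross_product G1 G2) k ->
  equitably_colorable (cross_product G2 G1) k.
Proof.
case/existsP=> c /andP[/forallP c_proper /forallP c_eq].
pose swap (p : G2 * G1) := (p.2, p.1).
have swap_inj : injective swap by move=> [? ?] [? ?] [-> ->].
pose c' : {ffun cross_product G2 G1 -> 'I_k} := [ffun p => c (swap p)].
apply/existsP; exists c'; apply/andP; split.
  apply/forallP => p; apply/forallP => q; apply/implyP => /andP[pq1 pq2].
  rewrite !ffunE; have /forallP/(_ (swap q))/implyP := c_proper (swap p).
  by apply; apply/andP.
have swap_class i : #|color_class c' i| = #|color_class c i|.
  rewrite -(card_imset _ swap_inj); apply: eq_card => -[a b].
  rewrite inE; apply/imsetP/idP => [[[b' a']]|cab].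
    by rewrite inE ffunE => ? [-> ->].
  by exists (b, a); rewrite ?inE ?ffunE.
apply/forallP => i; apply/forallP => j.
by rewrite !swap_class (forallP (c_eq i)).
Qed.

(** The edges of C_m x C_n are the two diagonals of the unit squares, wrapping
    around in both directions; this is the condition on the square whose lower
    corner is (x, y). *)
Definition diagonals_separated m n k (f : nat -> nat -> nat) x y :=
  let b x y := block (m * n) k (f x y) in
  (b x y != b (x.+1 %% m) (y.+1 %% n)) && (b x (y.+1 %% n) != b (x.+1 %% m) y).

Lemma equitably_colorable_numbering m n k (f : nat -> nat -> nat) :
    0 < k ->
    (forall x y, x < m -> y < n -> f x y < m * n) ->
    (forall x y x' y', x < m -> y < n -> x' < m -> y' < n ->
      f x y = f x' y' -> x = x' /\ y = y') ->
    (forall x y, x < m -> y < n -> diagonals_separated m n k f x y) ->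
  equitably_colorable (cross_product (cycle_graph m) (cycle_graph n)) k.
Proof.
move=> k0 f_lt f_inj f_sep.
have cardG : #|cross_product (cycle_graph m) (cycle_graph n)| = m * n.
  by rewrite card_prod !card_ord.
apply: (equitably_colorable_blocks
  (cross_product (cycle_graph m) (cycle_graph n)) k (fun p : 'I_m * 'I_n => f p.1 p.2)) => //.
- by move=> [x y]; rewrite cardG; apply: f_lt.
- move=> [x y] [x' y'] /= /f_inj[] // exx' eyy'.
  by congr (_, _); apply: val_inj.
move=> [x y] [x' y']; rewrite cardG => /andP[] /= /andP[_ xx'] /andP[_ yy'].
case/orP: xx' => /eqP->; case/orP: yy' => /eqP->.
- by have /andP[] := f_sep x y (ltn_ord x) (ltn_ord y).
- by have /andP[] := f_sep x y' (ltn_ord x) (ltn_ord y').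
- by rewrite eq_sym; have /andP[] := f_sep x' y (ltn_ord x') (ltn_ord y).
- by rewrite eq_sym; have /andP[] := f_sep x' y' (ltn_ord x') (ltn_ord y').
Qed.

Definition evens_first m x := if odd x then uphalf m + x./2 else x./2.

Lemma evens_first_lt m x : x < m -> evens_first m x < m.
Proof. by rewrite /evens_first; case: ifP; lia. Qed.

Lemma evens_first_inj m x x' : x < m -> x' < m ->
  evens_first m x = evens_first m x' -> x = x'.
Proof. by rewrite /evens_first; repeat case: ifP => ?; lia. Qed.

Lemma succ_modn n y : y < n ->
  y.+1 %% n = y.+1 /\ y.+1 < n \/ y.+1 %% n = 0 /\ y.+1 = n.
Proof.
rewrite leq_eqVlt => /orP[/eqP->|yn]; [right|left]; first by rewrite modnn.
by rewrite modn_small.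
Qed.

(** From an even x to x + 1 the rank increases by the number of even values
    below m; from an odd x it decreases by one less.  Around the cycle, m - 1
    and 0 are at distance m - 1 when m is even, (m - 1)/2 when m is odd. *)
Lemma evens_first_antibandwidth m x : 2 < m -> x < m ->
  evens_first m x + m.-1./2 <= evens_first m (x.+1 %% m) \/
  evens_first m (x.+1 %% m) + m.-1./2 <= evens_first m x.
Proof.
move=> m2 xm; rewrite /evens_first.
by case: (succ_modn m x xm) => -[-> ?] /=; case: ifP => ? /=; lia.
Qed.

(** The rank in the order 0, n-1, 1, n-2, 2, ..., which flattens the cycle into
    two interleaved strands. *)
Definition fold n y := if y.*2 < n then y.*2 else (n - y).*2.-1.

Lemma fold_lt n y : y < n -> fold n y < n.
Proof. by rewrite /fold; case: ifP; lia. Qed.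

Lemma fold_inj n y y' : y < n -> y' < n -> fold n y = fold n y' -> y = y'.
Proof. by rewrite /fold; repeat case: ifP => ?; lia. Qed.

Lemma fold_bandwidth n y : y < n ->
  fold n y <= fold n (y.+1 %% n) + 2 /\ fold n (y.+1 %% n) <= fold n y + 2.
Proof.
move=> yn; rewrite /fold.
by case: (succ_modn n y yn) => -[-> ?] /=; repeat case: ifP => ?; lia.
Qed.

Definition folded m n x y := evens_first m x * n + fold n y.

Lemma equitably_colorable_folded m n k : 0 < k ->
    (forall x y, x < m -> y < n ->
      diagonals_separated m n k (folded m n) x y) ->
  equitably_colorable (cross_product (cycle_graph m) (cycle_graph n)) k.
Proof.
move=> k0; apply: equitably_colorable_numbering => //.
  move=> x y /evens_first_lt xm /fold_lt yn; rewrite /folded; nia.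
move=> x y x' y' xm yn x'm y'n eq_f.
have [Fy Fy'] := (fold_lt n y yn, fold_lt n y' y'n).
have eq_x : evens_first m x = evens_first m x'.
  have := congr1 (divn^~ n) eq_f.
  by rewrite /folded !divnMDl ?divn_small ?addn0 //; lia.
split; first exact: evens_first_inj eq_x.
by apply: fold_inj yn y'n _; move: eq_f; rewrite /folded eq_x; lia.
Qed.

(** If b >= a + N/k then b*k/N >= a*k/N + 1, so the integer parts differ. *)
Lemma block_neq_far N k D a b : 0 < N -> N <= k * D ->
  a + D <= b \/ b + D <= a -> block N k a != block N k b.
Proof.
move=> N0; wlog ab : a b / a <= b => [hw kD far|kD].
  case: (leqP a b) => [ab|/ltnW ba]; first exact: hw.
  by rewrite eq_sym; apply: hw => //; case: far; tauto.
have D0 : 0 < D by case: D kD => //; rewrite muln0; lia.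
case=> [far|]; last by lia.
rewrite neq_ltn; apply/orP; left; rewrite /block leq_divRL //.
have := leq_trunc_div (a * k) N; nia.
Qed.

(** The row part of the numbering moves by at least d*n along an edge, where
    d = floor((m-1)/2), and the column part by at most 2. *)
Lemma equitably_colorable_of_gap m n k : 2 < m -> 2 < n ->
    m * n <= k * (m.-1./2 * n - 2) ->
  equitably_colorable (cross_product (cycle_graph m) (cycle_graph n)) k.
Proof.
move=> m2 n2 gap; apply: equitably_colorable_folded => [|x y xm yn]; first nia.
have mn0 : 0 < m * n by rewrite muln_gt0; lia.
have := evens_first_antibandwidth m x m2 xm.
have := fold_bandwidth n y yn.
rewrite /diagonals_separated /folded => bw ab.
by apply/andP; split; apply: (block_neq_far _ _ _ _ _ mn0 gap); nia.
Qed.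

(** The even rows are exactly the first half of the numbering. *)
Lemma equitably_2_colorable_even m n : 2 < m -> 2 < n -> ~~ odd m ->
  equitably_colorable (cross_product (cycle_graph m) (cycle_graph n)) 2.
Proof.
move=> m2 n2 m_even; apply: equitably_colorable_folded => // x y xm yn.
have row z t : z < m -> t < n -> block (m * n) 2 (folded m n z t) = odd z.
  move=> zm tn; have Ft := fold_lt n t tn.
  have mnE : m * n = m./2 * n * 2 by rewrite mulnAC muln2 even_halfK.
  have zh : z./2 < m./2 by lia.
  have mn0 : 0 < m * n by rewrite muln_gt0; lia.
  apply/eqP; rewrite /block eqn_leq -ltnS ltn_divLR // leq_divRL //.
  rewrite /folded /evens_first.
  have -> : uphalf m = m./2 by lia.
  rewrite mnE; move: (m./2) (z./2) (fold n t) zh Ft => h z' t' zh Ft.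
  by apply/andP; split; case: (odd z); nia.
have odd_succ : odd (x.+1 %% m) = ~~ odd x.
  by case: (succ_modn m x xm) => -[-> ?]; lia.
have ? : x.+1 %% m < m by apply: ltn_pmod; lia.
have ? : y.+1 %% n < n by apply: ltn_pmod; lia.
by rewrite /diagonals_separated !row // odd_succ; case: (odd x).
Qed.

(** * Small products *)

(** Shifting row x by x makes one family of diagonals preserve the position
    inside a row and the other move it by two columns, that is, mostly to the
    next place of the row, except where x wraps around.  This serves C_3 x C_3
    and, for some k, the products of C_4 with C_4, C_5 and C_8. *)
Definition skewed m n x y :=
  evens_first m x * n + evens_first n ((x + y) %% n).

(** C_4 x C_4 is the disjoint union of two graphs K_{4,4}, whose sides are the
    four classes of vertices by parity of both coordinates.  The sides are
    listed as P, R, Q, S where the components are P-Q and R-S; the three blocks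
    of sizes 6, 5, 5 then meet P and R, R and Q, Q and S. *)
Definition parity_classes_44 (m n x y : nat) :=
  odd x * 8 + (odd x (+) odd y) * 4 + x./2 * 2 + y./2.

Definition good_numbering m n k f :=
  [&& all (fun x => all (fun y => f x y < m * n) (iota 0 n)) (iota 0 m),
      uniq (mkseq (fun p => f (p %/ n) (p %% n)) (m * n))
    & all (fun x => all (diagonals_separated m n k f x) (iota 0 n)) (iota 0 m)].

Lemma equitably_colorable_good m n k f : 0 < k -> good_numbering m n k f ->
  equitably_colorable (cross_product (cycle_graph m) (cycle_graph n)) k.
Proof.
have inI x p : x < p -> x \in iota 0 p by rewrite mem_iota.
move=> k0 /and3P[/allP f_lt /mkseq_uniqP f_inj /allP f_sep].
apply: (equitably_colorable_numbering m n k f) => //.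
- by move=> x y /inI/f_lt/allP + /inI; apply.
- move=> x y x' y' xm yn x'm y'n eq_f.
  have split_rank a b : b < n -> (a * n + b) %/ n = a /\ (a * n + b) %% n = b.
    by move=> bn; rewrite divnMDl ?divn_small ?modnMDl ?modn_small ?addn0; lia.
  have [[q r] [q' r']] := (split_rank x y yn, split_rank x' y' y'n).
  have eq_rank : x * n + y = x' * n + y'.
    by apply: f_inj; rewrite ?inE ?q ?r ?q' ?r' //; nia.
  by move: q r; rewrite eq_rank q' r'.
by move=> x y /inI/f_sep/allP + /inI; apply.
Qed.

(** [f] takes the cycle lengths as arguments, so that it can be tried with the
    two factors exchanged. *)
Definition good_family m n k (f : nat -> nat -> nat -> nat -> nat) :=
  good_numbering m n k (f m n) || good_numbering n m k (f n m).

Lemma equitably_colorable_family m n k f : 0 < k -> good_family m n k f ->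
  equitably_colorable (cross_product (cycle_graph m) (cycle_graph n)) k.
Proof.
move=> k0 /orP[] good; first exact: equitably_colorable_good good.
by apply: equitably_colorable_swap; apply: equitably_colorable_good good.
Qed.

(** For each small triple, one of the three numberings works for the product
    in one of the two orders of its factors.  Testing the inequalities first
    leaves only 33 triples to inspect edge by edge. *)
Lemma small_products : all (fun m => all (fun n => all (fun k =>
    [|| m * n <= k * (m.-1./2 * n - 2), n * m <= k * (n.-1./2 * m - 2),
        good_family m n k folded
      | good_family m n k skewed || good_family m n k parity_classes_44])
  (iota 3 6)) (iota 3 6)) (iota 3 6).
Proof. by vm_compute. Qed.

Lemma equitably_colorable_ge3 m n k : 2 < m -> 2 < n -> 2 < k ->
  equitably_colorable (cross_product (cycle_graph m) (cycle_graph n)) k.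
Proof.
move=> m2 n2 k2; have k0 : 0 < k by lia.
case: (leqP (m * n) (k * (m.-1./2 * n - 2))) => [|gap].
  exact: equitably_colorable_of_gap.
case: (leqP (n * m) (k * (n.-1./2 * m - 2))) => [gap'|gap'].
  by apply/equitably_colorable_swap/equitably_colorable_of_gap.
(* For m >= 9 the inequality m*n <= 3*(d*n - 2) holds for every n >= 3. *)
have m8 : m < 9 by nia.
have n8 : n < 9 by nia.
have k8 : k < 9.
  rewrite ltnNge; apply/negP => k9.
  (* From p <= 2*d + 2, where d = floor((p-1)/2), a failure for k >= 9 gives
     (7*d - 2)*q < 18.  Failing in both orders leaves only p = q = 3, where
     k*(d*q - 2) = k >= 9 = p*q is no failure. *)
  have narrow p q : 2 < p -> 2 < q ->
      k * (p.-1./2 * q - 2) < p * q -> q <= 3.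
    move=> p2 q2; have : 0 < p.-1./2 by lia.
    have : p <= p.-1./2 * 2 + 2 by lia.
    move: (p.-1./2) => d pd d0 gap_pq; rewrite leqNgt; apply/negP => q4.
    nia.
  have n3 : n = 3 by have := narrow m n m2 n2 gap; lia.
  have m3 : m = 3 by have := narrow n m n2 m2 gap'; lia.
  by move: gap; rewrite n3 m3 /=; lia.
have in3 a : 2 < a -> a < 9 -> a \in iota 3 6.
  by move=> a2 a9; rewrite mem_iota; lia.
have /allP/(_ n (in3 n n2 n8))/allP/(_ k (in3 k k2 k8))/or4P[] :=
  allP small_products m (in3 m m2 m8).
- by rewrite leqNgt gap.
- by rewrite leqNgt gap'.
- exact: equitably_colorable_family.
by case/orP; exact: equitably_colorable_family.
Qed.

(** * Lower bounds *)

Lemma ordS_neq n (i : 'I_n) : 1 < n -> i != ordS i.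
Proof.
move=> n1; rewrite -val_eqE /=.
by case: (succ_modn n i (ltn_ord i)) => -[-> ?]; lia.
Qed.

(** The walk that increases both coordinates at every step; it closes up after
    m * n steps. *)
Definition diagonal m n (m0 : 0 < m) (n0 : 0 < n) t :
    cross_product (cycle_graph m) (cycle_graph n) :=
  (Ordinal (ltn_pmod t m0), Ordinal (ltn_pmod t n0)).

Lemma diagonal_adj m n (m0 : 0 < m) (n0 : 0 < n) t : 1 < m -> 1 < n ->
  adj (diagonal m n m0 n0 t) (diagonal m n m0 n0 t.+1).
Proof.
have step p (p0 : 0 < p) : 1 < p ->
    cycle_adj (Ordinal (ltn_pmod t p0)) (Ordinal (ltn_pmod t.+1 p0)).
  move=> p1.
  have -> : Ordinal (ltn_pmod t.+1 p0) = ordS (Ordinal (ltn_pmod t p0)).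
    by apply: val_inj; rewrite /= -addn1 -modnDml addn1.
  by rewrite /cycle_adj eqxx ordS_neq.
by move=> m1 n1; apply/andP; split; apply: step.
Qed.

Lemma color_count_gt1 m n k : 1 < m -> 1 < n ->
  equitably_colorable (cross_product (cycle_graph m) (cycle_graph n)) k ->
  1 < k.
Proof.
move=> m1 n1 /existsP[c /andP[/forallP c_proper _]].
pose v := diagonal m n (ltnW m1) (ltnW n1).
have /forallP/(_ (v 1))/implyP := c_proper (v 0).
move/(_ (diagonal_adj m n _ _ 0 m1 n1)).
by case: (c (v 0)) (c (v 1)) => [a ak] [b bk]; rewrite -val_eqE /=; lia.
Qed.

(** With at most two colors the color alternates along any walk, which is
    impossible on a closed walk of odd length. *)
Lemma color_count_gt2_odd m n k : 1 < m -> 1 < n -> odd m -> odd n ->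
  equitably_colorable (cross_product (cycle_graph m) (cycle_graph n)) k ->
  2 < k.
Proof.
move=> m1 n1 m_odd n_odd /existsP[c /andP[/forallP c_proper _]].
rewrite ltnNge; apply/negP => k2.
pose v := diagonal m n (ltnW m1) (ltnW n1).
have alternate t : (val (c (v t)) == 0) = (val (c (v 0)) == 0) (+) odd t.
  elim: t => [|t IHt]; first by rewrite addbF.
  rewrite oddS addbN -IHt.
  have /forallP/(_ (v t.+1))/implyP := c_proper (v t).
  move/(_ (diagonal_adj m n _ _ t m1 n1)).
  by case: (c (v t)) (c (v t.+1)) => [a ak] [b bk]; rewrite -val_eqE /=; lia.
have closed : v (m * n) = v 0.
  by congr (_, _); apply: val_inj; rewrite /= ?modnMr ?modnMl mod0n.
have := alternate (m * n); rewrite closed oddM m_odd n_odd.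
by case: (_ == 0).
Qed.

(** * Chromatic number and threshold *)

Lemma equitable_chromatic_number_threshold (G : sgraph) r :
    (forall k, equitably_colorable G k = (r <= k)) ->
  equitable_chromatic_number G = r /\ equitable_chromatic_threshold G = r.
Proof.
move=> colE; split.
  rewrite /equitable_chromatic_number; case: ex_minnP => s; rewrite colE => rs.
  by move/(_ r); rewrite colE leqnn => /(_ isT); lia.
rewrite /equitable_chromatic_threshold; case: ex_minnP => s /boolp.asboolP col.
have rs : r <= s by rewrite -colE; apply: col.
move=> /(_ r) min; apply/eqP; rewrite eqn_leq rs andbT; apply: min.
by apply/boolp.asboolP => k; rewrite colE.
Qed.

Theorem theorem11 (m n : nat) (hm : 3 <= m) (hn : 3 <= n) :
  equitable_chromatic_number (cross_product (cycle_graph m) (cycle_graph n))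
    = equitable_chromatic_threshold
        (cross_product (cycle_graph m) (cycle_graph n))
  /\ equitable_chromatic_threshold
        (cross_product (cycle_graph m) (cycle_graph n))
    = (if ~~ odd (m * n) then 2 else 3).
Proof.
have col3 k : 2 < k -> equitably_colorable
    (cross_product (cycle_graph m) (cycle_graph n)) k.
  exact: equitably_colorable_ge3.
suff /equitable_chromatic_number_threshold[-> ->] : forall k,
    equitably_colorable (cross_product (cycle_graph m) (cycle_graph n)) k
      = ((if ~~ odd (m * n) then 2 else 3) <= k) by [].
move=> k; apply/idP/idP => [col|].
  case: ifPn => [_|].
    exact: (color_count_gt1 m n k (ltnW hm) (ltnW hn) col).
  rewrite negbK oddM => /andP[m_odd n_odd].
  exact: (color_count_gt2_odd m n k (ltnW hm) (ltnW hn) m_odd n_odd col).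
case: ifPn => [mn_even|_]; last exact: col3.
rewrite leq_eqVlt => /predU1P[<-|]; last exact: col3.
move: mn_even; rewrite oddM negb_and => /orP[m_even|n_even].
  exact: equitably_2_colorable_even.
exact/equitably_colorable_swap/equitably_2_colorable_even.
Qed.
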